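(* Let $F_1,\dots,F_8\in\mathbb{C}[x,y,z]$ be linear forms such that the eight planes in $\mathbb{P}^3$ (coordinates $(x:y:z:t)$) given by $F_1=0,\dots,F_5=0$, $F_6+t=0$, $F_7+t=0$, $F_8+t=0$ form an octic arrangement; thus $A=(0:0:0:1)$ is a fivefold point of the arrangement (exactly five of the planes contain it). Then the double octic Calabi–Yau threefold defined by $$u^{2}=F_{1}F_{2}F_{3}F_{4}F_{5}(F_{6}+t)(F_{7}+t)(F_{8}+t)$$ is birational to the elliptic fibration (over $\mathbb{P}^2$ with coordinates $(x:y:z)$, with fibre coordinates $(t,u)$) $$u^{2} = \left(F_{1}F_{2}F_{3}F_{4}F_{5} F_{6}+t \right) \left(F_{1}F_{2}F_{3}F_{4}F_{5} F_{7}+t \right) \left(F_{1}F_{2}F_{3}F_{4}F_{5}F_{8}+t \right),$$ whose discriminant is $$\Delta = 16 (F_{1}F_{2}F_{3}F_{4}F_{5})^{6} (F_{7}-F_{8})^{2}(F_{6}-F_{8})^{2}(F_{6}-F_{7})^{2}$$ and whose $J$-invariant is $$J= \frac{4 \left(F_{6}^{2} + F_{7}^{2}+ F_{8}^{2}-F_{6} F_{7}-F_{6} F_{8}-F_{7} F_{8}\right)^{3}}{27 (F_{7}-F_{8})^{2} (F_{6}-F_{8})^{2} (F_{6}-F_{7})^{2}}.$$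
   Context: An octic arrangement is a union $D=P_1\cup\dots\cup P_8$ of eight distinct planes in $\mathbb{P}^3=\mathbb{P}^3_{\mathbb{C}}$ such that no six of the planes meet in a point and no four contain a common line. If $P_i$ has equation $\ell_i(x,y,z,t)=0$, the double octic defined by $D$ is a Calabi–Yau threefold obtained as a crepant resolution of the double cover of $\mathbb{P}^3$ branched along $D$, i.e. of the hypersurface $u^2=\ell_1\cdots \ell_8$ in the weighted projective space $\mathbb{P}(1,1,1,1,4)$; for birational questions it can be replaced by this hypersurface. The right-hand side of the elliptic fibration is homogeneous when $x,y,z$ have weight $1$, $t$ has weight $6$ and $u$ has weight $9$; equivalently, dehomogenizing (e.g. $z=1$), it is an elliptic curve over the function field of $\mathbb{P}^2$. For $u^2=(t-e_1)(t-e_2)(t-e_3)$ the discriminant is $\Delta=16\prod_{i<j}(e_i-e_j)^2$ and the $J$-invariant is normalized as $J=j/1728$, where $j$ is the usual $j$-invariant (so $J=1$ for $u^2=t^3-t$). *)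

(* Defs.v *)
From HB Require Import structures.
From mathcomp Require Import all_boot all_order all_algebra.
From mathcomp Require Import fraction ring.
From mathcomp Require Import mpoly.
From mathcomp Require Import reals.
From mathcomp Require Import complex.

Set Implicit Arguments.
Unset Strict Implicit.
Unset Printing Implicit Defensive.

Import GRing.Theory.
Local Open Scope ring_scope.

(* Weighted projective space P(w): the class of a nonzero vector under        *)
(* v ~ (l ^+ w i * v i)_i, l != 0.  Points are handled through                *)
(* representatives, and subsets of P(w) as predicates on representatives.     *)

Definition nonzero_vec (K : closedFieldType) (n : nat) (v : 'I_n -> K) : Prop :=
  exists i, v i != 0.

Definition wproj_eq (K : closedFieldType) (n : nat) (w : 'I_n -> nat)
    (v v' : 'I_n -> K) : Prop :=
  exists2 l : K, l != 0 & forall i, v' i = l ^+ w i * v i.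

Definition wdeg (n : nat) (w : 'I_n -> nat) (m : 'X_{1..n}) : nat :=
  (\sum_(i < n) w i * m i)%N.

Lemma wdeg0 (n : nat) (w : 'I_n -> nat) : wdeg w 0%MM = 0%N.
Proof. by rewrite /wdeg big1 // => i _; rewrite mnm0E muln0. Qed.

Lemma wdegD (n : nat) (w : 'I_n -> nat) : {morph wdeg w : m1 m2 / (m1 + m2)%MM >-> (m1 + m2)%N}.
Proof.
move=> m1 m2; rewrite /wdeg -big_split /=.
by apply: eq_bigr => i _; rewrite mnmDE mulnDr.
Qed.

HB.instance Definition _ (n : nat) (w : 'I_n -> nat) :=
  isMeasure.Build n (wdeg w) (wdeg0 w) (@wdegD n w).

(* The zero locus in P(w) of a polynomial, meant for one that is homogeneous  *)
(* for the weights w.                                                         *)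
Definition wproj_zeros (K : closedFieldType) (n : nat) (P : {mpoly K[n]})
    (v : 'I_n -> K) : Prop :=
  nonzero_vec v /\ P.@[v] = 0.

(* U is Zariski open in X; no finiteness of the family T is asked for, as     *)
(* polynomial rings are Noetherian.                                           *)
Definition zopen_in (K : closedFieldType) (n : nat) (w : 'I_n -> nat)
    (X U : ('I_n -> K) -> Prop) : Prop :=
  exists T : {mpoly K[n]} -> Prop,
    (forall p, T p -> exists d, p \is d.-homog for (wdeg w)) /\
    (forall v, U v <-> X v /\ exists2 p, T p & p.@[v] != 0).

Definition zdense_in (K : closedFieldType) (n : nat) (w : 'I_n -> nat)
    (X U : ('I_n -> K) -> Prop) : Prop :=
  forall W, zopen_in w X W -> (exists v, W v) -> exists v, W v /\ U v.

(* Regular functions are locally quotients of two weighted homogeneous        *)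
(* polynomials of the same degree.                                            *)
Definition regular_on (K : closedFieldType) (n : nat) (w : 'I_n -> nat)
    (U : ('I_n -> K) -> Prop) (g : ('I_n -> K) -> K) : Prop :=
  forall v, U v -> exists (d : nat) (p q : {mpoly K[n]}),
    [/\ p \is d.-homog for (wdeg w), q \is d.-homog for (wdeg w), q.@[v] != 0 &
        forall v', U v' -> q.@[v'] != 0 -> g v' = p.@[v'] / q.@[v']].

(* Morphisms of quasi-projective sets: maps on points that are continuous and *)
(* pull regular functions back to regular functions.                          *)
Record is_morphism (K : closedFieldType) (n m : nat)
    (w : 'I_n -> nat) (w' : 'I_m -> nat)
    (U : ('I_n -> K) -> Prop) (V : ('I_m -> K) -> Prop)
    (f : ('I_n -> K) -> ('I_m -> K)) : Prop := IsMorphism {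
  morphism_maps : forall v, U v -> V (f v);
  morphism_compat : forall v v', U v -> U v' ->
    wproj_eq w v v' -> wproj_eq w' (f v) (f v');
  morphism_cont : forall W, zopen_in w' V W ->
    zopen_in w U (fun v => U v /\ W (f v));
  morphism_regular : forall W g, zopen_in w' V W -> regular_on w' W g ->
    regular_on w (fun v => U v /\ W (f v)) (fun v => g (f v))
}.

Definition isomorphic_sets (K : closedFieldType) (n m : nat)
    (w : 'I_n -> nat) (w' : 'I_m -> nat)
    (U : ('I_n -> K) -> Prop) (V : ('I_m -> K) -> Prop) : Prop :=
  exists f g,
    [/\ is_morphism w w' U V f, is_morphism w' w V U g,
        forall v, U v -> wproj_eq w (g (f v)) v &
        forall v, V v -> wproj_eq w' (f (g v)) v].

Definition birational (K : closedFieldType) (n m : nat)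
    (w : 'I_n -> nat) (w' : 'I_m -> nat)
    (X : ('I_n -> K) -> Prop) (Y : ('I_m -> K) -> Prop) : Prop :=
  exists U V,
    [/\ zopen_in w X U, zdense_in w X U, zopen_in w' Y V, zdense_in w' Y V &
        isomorphic_sets w w' U V].

(* The equation u^2 = P, where u is a new last variable. *)
Definition double_cover (K : closedFieldType) (n : nat) (P : {mpoly K[n]}) :
    {mpoly K[n.+1]} :=
  'X_ord_max ^+ 2 - mwiden P.

(* The spanning vectors p, q of a line are taken linearly independent. *)
Definition contain_common_line (K : closedFieldType) (I : finType) (n : nat)
    (l : I -> {mpoly K[n]}) (S : {set I}) : Prop :=
  exists p q : 'I_n -> K,
    (forall a b : K, (forall i, a * p i + b * q i = 0) -> a = 0 /\ b = 0) /\
    (forall k, k \in S -> forall a b : K,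
       (l k).@[fun i => a * p i + b * q i] = 0).

Definition meet_in_a_point (K : closedFieldType) (I : finType) (n : nat)
    (l : I -> {mpoly K[n]}) (S : {set I}) : Prop :=
  exists v : 'I_n -> K,
    nonzero_vec v /\ forall k, k \in S -> (l k).@[v] = 0.

Record octic_arrangement (K : closedFieldType) (l : 'I_8 -> {mpoly K[4]}) :
    Prop := OcticArrangement {
  octic_linear : forall i, l i \is 1.-homog /\ l i != 0;
  octic_distinct : forall i j, i != j ->
    ~ (forall v, wproj_zeros (l i) v <-> wproj_zeros (l j) v);
  octic_no_six : forall S : {set 'I_8}, #|S| = 6%N -> ~ meet_in_a_point l S;
  octic_no_four : forall S : {set 'I_8}, #|S| = 4%N -> ~ contain_common_line l S
}.

(* y^2 + a1 x y + a3 y = x^3 + a2 x^2 + a4 x + a6, with its usual invariants. *)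
Record weierstrass (A : Type) := Weierstrass {
  wa1 : A; wa2 : A; wa3 : A; wa4 : A; wa6 : A
}.

Definition wb2 (A : comNzRingType) (W : weierstrass A) : A :=
  wa1 W ^+ 2 + 4%:R * wa2 W.
Definition wb4 (A : comNzRingType) (W : weierstrass A) : A :=
  2%:R * wa4 W + wa1 W * wa3 W.
Definition wb6 (A : comNzRingType) (W : weierstrass A) : A :=
  wa3 W ^+ 2 + 4%:R * wa6 W.
Definition wb8 (A : comNzRingType) (W : weierstrass A) : A :=
  wa1 W ^+ 2 * wa6 W + 4%:R * wa2 W * wa6 W - wa1 W * wa3 W * wa4 W
  + wa2 W * wa3 W ^+ 2 - wa4 W ^+ 2.
Definition wc4 (A : comNzRingType) (W : weierstrass A) : A :=
  wb2 W ^+ 2 - 24%:R * wb4 W.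
Definition wdisc (A : comNzRingType) (W : weierstrass A) : A :=
  - wb2 W ^+ 2 * wb8 W - 8%:R * wb4 W ^+ 3 - 27%:R * wb6 W ^+ 2
  + 9%:R * wb2 W * wb4 W * wb6 W.
Definition wj (K : fieldType) (W : weierstrass K) : K := wc4 W ^+ 3 / wdisc W.
Definition wJ (K : fieldType) (W : weierstrass K) : K := wj W / 1728%:R.

(* The curve u^2 = p(t); meant for p monic of degree 3. *)
Definition curve_of_cubic (A : comNzRingType) (p : {poly A}) : weierstrass A :=
  Weierstrass 0 p`_2 0 p`_1 p`_0.

Lemma prod3_XsubC_coef (A : comNzRingType) (e1 e2 e3 : A) :
  ('X - e1%:P) * ('X - e2%:P) * ('X - e3%:P) =
  'X^3 - (e1 + e2 + e3) *: 'X^2 + (e1 * e2 + e1 * e3 + e2 * e3) *: 'X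
  - (e1 * e2 * e3)%:P.
Proof. by rewrite -!mul_polyC !(polyCD, polyCM); ring. Qed.

Lemma wdisc_roots (A : comNzRingType) (e1 e2 e3 : A) :
  wdisc (curve_of_cubic (('X - e1%:P) * ('X - e2%:P) * ('X - e3%:P))) =
  16%:R * ((e1 - e2) ^+ 2 * (e1 - e3) ^+ 2 * (e2 - e3) ^+ 2).
Proof.
rewrite prod3_XsubC_coef /wdisc /wb2 /wb4 /wb6 /wb8 /=.
by rewrite !(coefD, coefN, coefZ, coefXn, coefX, coefC) /=; ring.
Qed.

Lemma wJ_lemniscatic (K : fieldType) : 6%:R != 0 :> K ->
  wJ (curve_of_cubic ('X^3 - 'X : {poly K})) = 1.
Proof.
move=> n6; rewrite /wJ /wj /wdisc /wc4 /wb2 /wb4 /wb6 /wb8 /=.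
rewrite !(coefD, coefN, coefXn, coefX) /=.
have : 2%:R * 3%:R != 0 :> K by rewrite -natrM.
rewrite mulf_eq0 negb_or => /andP[n2 n3].
have n64 : 64%:R != 0 :> K by rewrite (natrX _ 2 6) expf_neq0.
have n1728 : 1728%:R != 0 :> K.
  by rewrite (_ : 1728 = 2 ^ 6 * 3 ^ 3)%N // natrM !natrX mulf_neq0 ?expf_neq0.
rewrite (_ : - _ * _ - _ - _ + _ = 64%:R); last by ring.
rewrite (_ : _ ^+ 3 = 64%:R * 1728%:R); last by ring.
by rewrite [64%:R * _]mulrC mulfK // divff.
Qed.

(* A fibration u^2 = E over P^2, with E : {mpoly K[4]} in x, y, z, t: the     *)
(* equation of its fibres over K[x,y,z], and its generic fibre, over          *)
(* K(x,y,z).                                                                  *)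
Definition fibre_equation (K : closedFieldType) (E : {mpoly K[4]}) :
    weierstrass {mpoly K[3]} :=
  curve_of_cubic (muni E).

Definition generic_fibre (K : closedFieldType) (E : {mpoly K[4]}) :
    weierstrass {fraction {mpoly K[3]}} :=
  curve_of_cubic (map_poly (@tofrac _) (muni E)).

Definition elliptic_fibration (K : closedFieldType) (E : {mpoly K[4]}) : Prop :=
  [/\ muni E \is monic, size (muni E) = 4%N & wdisc (generic_fibre E) != 0].

(* Main.v *)
(* Write G = F1 ... F5.  Substituting T = G t, U = G u turns                  *)
(* u^2 = G (F6 + t) (F7 + t) (F8 + t) into the fibration, and G != 0 is the   *)
(* only thing needed to invert this.  In weighted coordinates the inverse     *)
(* (x : y : z : T / G : U / G) is also (G x : G y : G z : T : G^3 U), so both *)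
(* directions are given by polynomials.  The locus G != 0 is dense in a       *)
(* double cover u^2 = P because a form p restricts to a + b u on the cover;   *)
(* if it vanishes at both points over every x with P(x) G(x) != 0, then       *)
(* a = b = 0.  The invariants are read off the roots -G F6, -G F7, -G F8 of   *)
(* the right-hand side.                                                       *)

Require Import Defs.
From HB Require Import structures.
From mathcomp Require Import all_boot all_order all_algebra.
From mathcomp Require Import fraction ring.
From mathcomp Require Import mpoly.
From mathcomp Require Import reals.
From mathcomp Require Import complex.

Set Implicit Arguments.
Unset Strict Implicit.
Unset Printing Implicit Defensive.

Import GRing.Theory.
Local Open Scope ring_scope.

(** Multiplying the octic equation by [G ^+ 2] gives one factor [G] to each of the three planes
    missing the fivefold point, so [T = G t], [U = G u] maps the octic to the fibration. Both this
    map and its inverse, cleared of denominators, multiply each coordinate by a power of the quintic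
    [G]. They are therefore morphisms by [polynomial_map_morphism], and their composites are
    weighted rescalings by [G] ([scaling_map_comp]). Together with [double_cover_dense], which shows
    that [G != 0] meets every nonempty open subset of either cover, this gives [octic_birational].

    Differences of the roots [- (G * F6)], [- (G * F7)], [- (G * F8)] are divisible by [G]. Hence
    [G ^+ 6] appears in the discriminant, and it cancels in J against the cube of [wc4]
    ([wdisc_scaled_roots], [wJ_scaled_roots]). The arrangement makes [G] nonzero and [F6], [F7],
    [F8] distinct, so the generic fibre is smooth. *)

Local Notation widen := (widen_ord (leqnSn _)).

(** * Multivariate polynomials as univariate ones in the last variable *)

Lemma widenE (n : nat) (i : 'I_n) : widen i = lift ord_max i.
Proof. by apply: ord_inj; rewrite lift_max. Qed.

Lemma muni_mwiden (n : nat) (A : comNzRingType) (p : {mpoly A[n]}) :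
  muni (mwiden p) = p%:P.
Proof.
have XP (m : 'X_{1..n}) : muni 'X_[A, mnmwiden m] = 'X_[m]%:P.
  rewrite muniE msuppX big_seq1 mcoeffX eqxx scale1r mnmwiden_ordmax expr0.
  rewrite alg_polyC; congr ('X_[_]%:P); apply/mnmP=> i.
  by rewrite mnmE mnmwiden_widen.
rewrite [p]mpolyE (raddf_sum (@mwiden n A)) (raddf_sum (@muni n A)) raddf_sum /=.
by apply: eq_bigr => m _; rewrite mwidenZ mwidenX muniZ XP -mul_polyC -polyCM mul_mpolyC.
Qed.

Lemma muni_Xmax (n : nat) (A : comNzRingType) :
  muni ('X_ord_max : {mpoly A[n.+1]}) = 'X.
Proof.
rewrite muniE msuppX big_seq1 mcoeffX eqxx scale1r mnm1E eqxx expr1.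
rewrite (_ : [multinom _ | i < n] = 0%MM) ?mpolyX0 ?scale1r //.
by apply/mnmP=> i; rewrite mnmE mnm1E mnm0E -val_eqE /= gtn_eqF.
Qed.

Lemma muniK (n : nat) (A : comNzRingType) (p : {mpoly A[n.+1]}) :
  (map_poly (@mwiden n A) (muni p)).['X_ord_max] = p.
Proof.
rewrite muniE [p in RHS]mpolyE !raddf_sum /= horner_sum.
apply: eq_bigr => m _.
rewrite -!mul_polyC !rmorphM /= map_polyXn hornerM hornerXn map_polyC hornerC /=.
rewrite mwidenZ mwidenX -scalerAl; congr (_ *: _).
rewrite mpolyXn -mpolyXD; congr 'X_[_]; apply/mnmP=> i.
rewrite mnmDE mulmnE mnm1E.
case: (unliftP ord_max i) => [j|] ->; last first.
  by rewrite mnmwiden_ordmax eqxx mul1n.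
by rewrite -widenE mnmwiden_widen mnmE -val_eqE /= gtn_eqF // addn0.
Qed.

Lemma meval_mwiden (n : nat) (A : comNzRingType) (p : {mpoly A[n]})
    (v : 'I_n.+1 -> A) :
  (mwiden p).@[v] = p.@[fun i => v (widen i)].
Proof.
rewrite [p]mpolyE (raddf_sum (@mwiden n A)) !raddf_sum /=; apply: eq_bigr => m _.
rewrite mwidenZ mwidenX !mevalZ !mevalX big_ord_recr /= mnmwiden_ordmax.
rewrite expr0 mulr1; congr (_ * _).
by apply: eq_bigr => i _; rewrite mnmwiden_widen.
Qed.

Lemma meval_muni (n : nat) (A : comNzRingType) (p : {mpoly A[n.+1]})
    (v : 'I_n.+1 -> A) :
  p.@[v] = (map_poly (meval (fun i => v (widen i))) (muni p)).[v ord_max].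
Proof.
rewrite -[p in LHS]muniK -[LHS]horner_map /= mevalXU.
congr _.[_]; apply/polyP=> i.
by rewrite !coef_map /= meval_mwiden.
Qed.

Definition extend (T : Type) (n : nat) (x : 'I_n -> T) (u : T) (i : 'I_n.+1) : T :=
  if unlift ord_max i is Some j then x j else u.

Lemma extend_widen (T : Type) (n : nat) (x : 'I_n -> T) (u : T) (i : 'I_n) :
  extend x u (widen i) = x i.
Proof. by rewrite /extend widenE liftK. Qed.

Lemma extend_max (T : Type) (n : nat) (x : 'I_n -> T) (u : T) :
  extend x u ord_max = u.
Proof. by rewrite /extend unlift_none. Qed.

(** Induction on the number of variables: where the leading coefficient in the last variable does
    not vanish, specialisation leaves a nonzero univariate polynomial, and an algebraically closed
    field is infinite. *)
Lemma mpoly_nonroot (K : closedFieldType) (n : nat) (p : {mpoly K[n]}) :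
  p != 0 -> exists v, p.@[v] != 0.
Proof.
elim: n p => [|n IHn] p p0.
  exists (fun=> 0); apply: contra p0 => /eqP p0.
  apply/eqP; rewrite [p]mpolyE big1_seq // => m _.
  rewrite (_ : p@_m = 0) ?scale0r // -p0 mevalE.
  have m0 (m' : 'X_{1..0}) : m' = 0%MM by apply/mnmP; case.
  rewrite [m]m0 [p in LHS]mpolyE raddf_sum /=; apply: eq_bigr => m' _.
  by rewrite mcoeffZ [m']m0 mcoeffX eqxx big_ord0.
have /IHn[x xP] : lead_coef (muni p) != 0.
  rewrite lead_coef_eq0; apply: contra p0 => /eqP p0.
  by rewrite -[p]muniK p0 rmorph0 horner0.
have /closed_nonrootP[u uP] : map_poly (meval x) (muni p) != 0.
  by apply: contra xP => /eqP/polyP/(_ (size (muni p)).-1); rewrite coef_map coef0 => /eqP.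
exists (extend x u); rewrite meval_muni extend_max.
move: uP; rewrite /root; congr (~~ (_.[_] == _)).
apply/polyP=> i; rewrite !coef_map /=; apply: meval_eq => j.
by rewrite extend_widen.
Qed.

(** * Density of a nonvanishing locus in a double cover *)

Lemma meval_double_cover (K : closedFieldType) (n : nat) (P : {mpoly K[n]})
    (v : 'I_n.+1 -> K) :
  (double_cover P).@[v] = v ord_max ^+ 2 - P.@[fun i => v (widen i)].
Proof. by rewrite mevalB rmorphXn /= mevalXU meval_mwiden. Qed.

(** Division by the monic ['X^2 - P] in the last variable: on the cover only the remainder, of
    degree at most one, survives. *)
Lemma mod_double_cover (K : closedFieldType) (n : nat) (P : {mpoly K[n]})
    (p : {mpoly K[n.+1]}) :
  exists a b : {mpoly K[n]}, forall v, (double_cover P).@[v] = 0 ->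
    p.@[v] = a.@[fun i => v (widen i)] + b.@[fun i => v (widen i)] * v ord_max.
Proof.
pose m : {poly {mpoly K[n]}} := 'X^2 - P%:P.
have sm : size m = 3%N by rewrite size_XnsubC.
have mm : m \is monic by rewrite monicXnsubC.
pose r := Pdiv.CommonRing.rmodp (muni p) m.
exists r`_0, r`_1 => v.
rewrite meval_double_cover meval_muni => vP.
rewrite (Pdiv.RingMonic.rdivp_eq mm (muni p)) -/r.
rewrite rmorphD rmorphM hornerD hornerM /=.
have -> : (map_poly (meval (fun i => v (widen i))) m).[v ord_max] = 0.
  by rewrite rmorphB /= map_polyXn map_polyC !hornerE.
rewrite mulr0 add0r.
have sr : (size (map_poly (meval (fun i => v (widen i))) r) <= 2)%N.
  have : (size r <= 2)%N.
    by have := Pdiv.CommonRing.ltn_rmodp (muni p) m; rewrite -/r sm -size_poly_eq0 sm.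
  exact: leq_trans (size_poly _ _).
by rewrite (horner_coef_wide _ sr) !big_ord_recl big_ord0 !coef_map /= addr0 expr0 mulr1 expr1.
Qed.

(** The condition [Q.@[fun=> 0] = 0] forces the base coordinates of a point with [Q != 0] to be not
    all zero, so the points constructed are genuine points of weighted projective space. *)
Lemma double_cover_dense (K : closedFieldType) (n : nat) (w : 'I_n.+1 -> nat)
    (P Q : {mpoly K[n]}) :
  2%:R != 0 :> K -> P != 0 -> Q != 0 -> Q.@[fun=> 0] = 0 ->
  zdense_in w (wproj_zeros (double_cover P))
    (fun v => wproj_zeros (double_cover P) v /\ (mwiden Q).@[v] != 0).
Proof.
move=> two0 P0 Q0 Qz W [T [_ WE]] [v /WE[[_ vX] [p Tp pv]]].
have [a [b abE]] := mod_double_cover P p.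
have [x [xP xQ xab]] : exists x, [/\ P.@[x] != 0, Q.@[x] != 0 &
    (a.@[x] != 0) || (b.@[x] != 0)].
  have : (a != 0) || (b != 0).
    rewrite -negb_and; apply: contra pv => /andP[/eqP a0 /eqP b0].
    by rewrite abE // a0 b0 !meval0 mul0r addr0.
  case/orP=> c0.
  - have : P * Q * a != 0 by rewrite !mulf_neq0.
    move=> /mpoly_nonroot[x]; rewrite !mevalM !mulf_eq0 !negb_or.
    by move=> /andP[/andP[xP xQ] xa]; exists x; rewrite xa.
  - have : P * Q * b != 0 by rewrite !mulf_neq0.
    move=> /mpoly_nonroot[x]; rewrite !mevalM !mulf_eq0 !negb_or.
    by move=> /andP[/andP[xP xQ] xb]; exists x; rewrite xb orbT.
have [u uP] : exists u : K, u ^+ 2 = P.@[x].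
  (* Degree 2 with constant coefficient [P.@[x]] and linear coefficient 0: the solution is a square
     root. *)
  have [u] := solve_monicpoly (fun i => if i == 0%N then P.@[x] else 0) (ltn0Sn 1).
  rewrite !big_ord_recl big_ord0 /= mul0r !addr0 expr0 mulr1 => uE.
  by exists u.
have u0 : u != 0 by apply: contra xP => /eqP u0; rewrite -uP u0 expr0n.
have ptE s q : q.@[fun i => extend x s (widen i)] = q.@[x].
  by apply: meval_eq => i; rewrite extend_widen.
have ptX s : s ^+ 2 = P.@[x] -> (double_cover P).@[extend x s] = 0.
  by move=> sE; rewrite meval_double_cover ptE extend_max sE subrr.
(* The two values are [a + b u] and [a - b u] at [x]; if both vanished, so would their sum [2 a] and
   difference [2 u b]. *)
have : (p.@[extend x u] != 0) || (p.@[extend x (- u)] != 0).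
  rewrite -negb_and; apply/negP=> /andP[].
  rewrite !abE ?ptX ?sqrrN // !ptE !extend_max => /eqP e1 /eqP e2.
  case/orP: xab => /negP; apply.
  - have : 2%:R * a.@[x] = 0 by rewrite -[RHS](addr0 0) -{1}e1 -e2; ring.
    by move/eqP; rewrite mulf_eq0 (negPf two0).
  - have : 2%:R * u * b.@[x] = 0 by rewrite -[RHS](subr0 0) -{1}e1 -e2; ring.
    by move/eqP; rewrite !mulf_eq0 (negPf two0) (negPf u0).
have main s : s ^+ 2 = P.@[x] -> p.@[extend x s] != 0 -> exists v, W v /\
    (wproj_zeros (double_cover P) v /\ (mwiden Q).@[v] != 0).
  move=> sP ps; exists (extend x s).
  have X : wproj_zeros (double_cover P) (extend x s).
    split; last exact: ptX.
    have [i xi] : exists i, x i != 0.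
      apply/existsP; apply: contraNT xQ; rewrite negb_exists => /forallP x0.
      rewrite -Qz; apply/eqP/meval_eq => i; apply/eqP.
      by rewrite -[_ == _]negbK.
    by exists (widen i); rewrite extend_widen.
  by rewrite WE meval_mwiden ptE; split; [split=> //; exists p|].
by case/orP=> /main; apply; rewrite ?sqrrN.
Qed.

(** * Weighted homogeneous polynomials and the maps they define *)

Section WeightedHomogeneity.
Context (K : closedFieldType).
Implicit Types n m d e : nat.

Lemma meval_scale n (w : 'I_n -> nat) d (p : {mpoly K[n]}) (l : K) v :
  p \is d.-homog for (wdeg w) ->
  p.@[fun i => l ^+ w i * v i] = l ^+ d * p.@[v].
Proof.
move=> /dhomogP hp; rewrite !mevalE mulr_sumr.
rewrite !big_seq; apply: eq_bigr => m /hp <-.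
rewrite mulrCA; congr (_ * _); rewrite /= /wdeg expr_sum -big_split /=.
by apply: eq_bigr => i _; rewrite exprMn exprM.
Qed.

Lemma dhomog_mPo n m (w : 'I_n -> nat) (w' : 'I_m -> nat) e d
    (phi : m.-tuple {mpoly K[n]}) (p : {mpoly K[m]}) :
  (forall i, tnth phi i \is (e * w' i).-homog for (wdeg w)) ->
  p \is d.-homog for (wdeg w') ->
  p \mPo phi \is (e * d).-homog for (wdeg w).
Proof.
move=> hphi /dhomogP hp; rewrite comp_mpolyE big_seq.
apply: rpred_sum => k /hp <-; apply: dhomogZ.
rewrite /= /wdeg big_distrr /=.
apply: (big_rec2 (fun c q => q \is c.-homog for (wdeg w))); first exact: dhomog1.
by move=> i c q _ hq; rewrite mulnA; apply: dhomogM => //; apply: dhomogMn.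
Qed.

Lemma dhomog_mwiden n (w : 'I_n.+1 -> nat) d (p : {mpoly K[n]}) :
  p \is d.-homog for (wdeg (fun i => w (widen i))) ->
  mwiden p \is d.-homog for (wdeg w).
Proof.
move=> /dhomogP hp; rewrite [p]mpolyE (raddf_sum (@mwiden n K)) big_seq /=.
apply: rpred_sum => m /hp <-; rewrite mwidenZ mwidenX; apply: dhomogZ.
rewrite dhomogX /= /wdeg big_ord_recr /= mnmwiden_ordmax muln0 addn0.
by apply/eqP/eq_bigr => i _; rewrite mnmwiden_widen.
Qed.

Lemma dhomog_wdeg1 n (w : 'I_n -> nat) d (p : {mpoly K[n]}) :
  (forall i, w i = 1%N) -> p \is d.-homog -> p \is d.-homog for (wdeg w).
Proof.
move=> w1 /dhomogP hp; apply/dhomogP=> m /hp <-.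
by rewrite /= /wdeg mdegE; apply: eq_bigr => i _; rewrite w1 mul1n.
Qed.

(** Scaling by zero fixes the origin and multiplies the value by [0 ^+ d.+1 = 0]. *)
Lemma meval_homog0 n d (p : {mpoly K[n]}) : p \is d.+1.-homog -> p.@[fun=> 0] = 0.
Proof.
have w1 (i : 'I_n) : (fun=> 1%N) i = 1%N by [].
move=> /(dhomog_wdeg1 w1)/(meval_scale 0 (fun=> 0)).
rewrite (expr0n _ d.+1) /= (mul0r p.@[_]) => e.
by rewrite -[RHS]e; apply: meval_eq => i; rewrite mulr0.
Qed.

Lemma dhomogXU n (w : 'I_n -> nat) i :
  ('X_i : {mpoly K[n]}) \is (w i).-homog for (wdeg w).
Proof.
rewrite dhomogX /= /wdeg (bigD1 i) //= mnm1E eqxx muln1 big1 ?addn0 // => j ij.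
by rewrite mnm1E eq_sym (negPf ij) muln0.
Qed.

(* The factor e absorbs the rescaling of the target by a form of degree e - 1 *)
(* used to clear denominators.                                                *)
Lemma polynomial_map_morphism n m (w : 'I_n -> nat) (w' : 'I_m -> nat) e
    (U : ('I_n -> K) -> Prop) (V : ('I_m -> K) -> Prop)
    (phi : m.-tuple {mpoly K[n]}) :
  (forall i, tnth phi i \is (e * w' i).-homog for (wdeg w)) ->
  (forall v, U v -> V (fun i => (tnth phi i).@[v])) ->
  is_morphism w w' U V (fun v i => (tnth phi i).@[v]).
Proof.
move=> hphi UV; split=> //.
- move=> v v' _ _ [l l0 vv']; exists (l ^+ e); first exact: expf_neq0.
  move=> i; rewrite -exprM -(meval_scale l v (hphi i)); exact: meval_eq.
- move=> W [T [hT WE]]; exists (fun q => exists2 p, T p & q = p \mPo phi).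
  split=> [q [p /hT[d hp] ->]|v].
    by exists (e * d)%N; apply: dhomog_mPo hp.
  split=> [[Uv /WE[_ [p Tp pv]]]|[Uv [q [p Tp ->]]]].
    by split=> //; exists (p \mPo phi); [exists p|rewrite comp_mpoly_meval].
  rewrite comp_mpoly_meval => pv; split=> //; apply/WE; split; first exact: UV.
  by exists p.
- move=> W g _ hg v [Uv /hg[d [p [q [hp hq qv gE]]]]].
  exists (e * d)%N, (p \mPo phi), (q \mPo phi).
  split; rewrite ?comp_mpoly_meval //; try exact: dhomog_mPo.
  by move=> v' [Uv' Wv']; rewrite !comp_mpoly_meval => qv'; apply: gE.
Qed.

End WeightedHomogeneity.

(** * The substitution [T = G t], [U = G u] *)

Section Birationality.
Context (K : closedFieldType).
Implicit Types (F G Q : {mpoly K[3]}) (a b w : 'I_5 -> nat) (v : 'I_5 -> K).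

Definition base_point v : 'I_3 -> K := fun i => v (widen (widen i)).

Lemma meval_mwiden2 F v : (mwiden (mwiden F)).@[v] = F.@[base_point v].
Proof. by rewrite !meval_mwiden. Qed.

Lemma dhomog_mwiden2 w d F : (forall i : 'I_3, w (widen (widen i)) = 1%N) ->
  F \is d.-homog -> mwiden (mwiden F) \is d.-homog for (wdeg w).
Proof. by move=> w1 hF; do 2!apply: dhomog_mwiden; apply: dhomog_wdeg1. Qed.

Lemma nonzero_vec_base d F v :
  F \is d.+1.-homog -> F.@[base_point v] != 0 -> nonzero_vec v.
Proof.
move=> hF Fv; apply/existsP; apply: contraNT Fv; rewrite negb_exists => /forallP v0.
rewrite -(meval_homog0 hF); apply/eqP/meval_eq => i.
by apply/eqP; rewrite -[_ == _]negbK v0.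
Qed.

(* With (a_i) = (0,0,0,1,1) this is (x, y, z, G t, G u), and with (1,1,1,0,3) *)
(* it is (G x, G y, G z, t, G^3 u).                                           *)
Definition scaling_map G a : 5.-tuple {mpoly K[5]} :=
  [tuple mwiden (mwiden G) ^+ a i * 'X_i | i < 5].

Lemma scaling_mapE G a v i :
  (tnth (scaling_map G a) i).@[v] = G.@[base_point v] ^+ a i * v i.
Proof. by rewrite tnth_mktuple mevalM rmorphXn /= mevalXU meval_mwiden2. Qed.

(** The balance of exponents matches the degree of [G ^+ a i * 'X_i] with the target weight. For
    [d = 5] it holds with [e = 1] for (0,0,0,1,1), whence the weights 6 = 5 + 1 and 9 = 5 + 4, and
    with [e = 6] for (1,1,1,0,3). *)
Lemma scaling_map_homog G a w w' d e :
  G \is d.-homog -> (forall i : 'I_3, w (widen (widen i)) = 1%N) ->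
  (forall i, d * a i + w i = e * w' i)%N ->
  forall i, tnth (scaling_map G a) i \is (e * w' i).-homog for (wdeg w).
Proof.
move=> hG w1 aw i; rewrite tnth_mktuple -aw; apply: dhomogM (dhomogXU _ _ _).
by apply: dhomogMn; apply: dhomog_mwiden2.
Qed.

Lemma meval_scaling_map G F a c d v :
  F \is d.-homog -> (forall i : 'I_3, a (widen (widen i)) = c) ->
  F.@[base_point (fun i => (tnth (scaling_map G a) i).@[v])] =
  G.@[base_point v] ^+ (c * d) * F.@[base_point v].
Proof.
have w1 (i : 'I_3) : (fun=> 1%N) i = 1%N by [].
move=> /(dhomog_wdeg1 w1) hF ac; rewrite exprM -(meval_scale _ _ hF).
by apply: meval_eq => i; rewrite expr1 -(ac i) -scaling_mapE.
Qed.

(** The first map turns the value of [G] into its power [(c * d).+1], so the composite multiplies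
    coordinate [i] by [G] to the power [(c * d).+1 * b i + a i = w i]. This is the weighted scaling
    by [G], and its inverse leads back to [v]. *)
Lemma scaling_map_comp G a b w c d v :
  G \is d.-homog -> (forall i : 'I_3, a (widen (widen i)) = c) ->
  (forall i, (c * d).+1 * b i + a i = w i)%N -> G.@[base_point v] != 0 ->
  wproj_eq w (fun i => (tnth (scaling_map G b) i).@[
                         fun j => (tnth (scaling_map G a) j).@[v]]) v.
Proof.
move=> hG ac abw Gv; exists G.@[base_point v]^-1; first by rewrite invr_eq0.
move=> i; rewrite scaling_mapE (meval_scaling_map _ _ hG ac) -exprSr scaling_mapE.
by rewrite -exprM [X in _ * X]mulrA -exprD abw mulrA -exprMn mulVf // expr1n mul1r.
Qed.

Lemma zopen_in_nonroot w d (X : ('I_5 -> K) -> Prop) (Q : {mpoly K[5]}) :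
  Q \is d.-homog for (wdeg w) -> zopen_in w X (fun v => X v /\ Q.@[v] != 0).
Proof.
move=> hQ; exists (eq^~ Q); split=> [_ ->|v]; first by exists d.
by split=> -[Xv]; [move=> Qv; split=> //; exists Q | case=> _ ->].
Qed.

Definition octic_form G F6 F7 F8 : {mpoly K[4]} :=
  mwiden G * (mwiden F6 + 'X_ord_max) * (mwiden F7 + 'X_ord_max) * (mwiden F8 + 'X_ord_max).

Definition fibration_form G F6 F7 F8 : {mpoly K[4]} :=
  (mwiden (G * F6) + 'X_ord_max) * (mwiden (G * F7) + 'X_ord_max) *
  (mwiden (G * F8) + 'X_ord_max).

Lemma meval_octic G F6 F7 F8 v :
  (double_cover (octic_form G F6 F7 F8)).@[v] = v ord_max ^+ 2 -
    G.@[base_point v] * (F6.@[base_point v] + v (widen ord_max)) *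
    (F7.@[base_point v] + v (widen ord_max)) * (F8.@[base_point v] + v (widen ord_max)).
Proof.
by rewrite meval_double_cover !(mevalM, mevalD) mevalXU !meval_mwiden.
Qed.

Lemma meval_fibration G F6 F7 F8 v :
  (double_cover (fibration_form G F6 F7 F8)).@[v] = v ord_max ^+ 2 -
    (G.@[base_point v] * F6.@[base_point v] + v (widen ord_max)) *
    (G.@[base_point v] * F7.@[base_point v] + v (widen ord_max)) *
    (G.@[base_point v] * F8.@[base_point v] + v (widen ord_max)).
Proof.
rewrite meval_double_cover /fibration_form.
by rewrite (mevalM _ (_ * _)) (mevalM _ (_ + _)) !mevalD mevalXU !meval_mwiden !mevalM.
Qed.

Lemma muni_fibration G F6 F7 F8 :
  muni (fibration_form G F6 F7 F8) =
  ('X - (- (G * F6))%:P) * ('X - (- (G * F7))%:P) * ('X - (- (G * F8))%:P).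
Proof.
have h c : muni (mwiden c + 'X_ord_max) = 'X - (- c)%:P :> {poly {mpoly K[3]}}.
  by rewrite muniD muni_mwiden muni_Xmax polyCN opprK addrC.
by rewrite (muniM (_ * _)) (muniM (_ + _)) !h.
Qed.

Lemma fibration_form_neq0 G F6 F7 F8 : fibration_form G F6 F7 F8 != 0.
Proof.
have : muni (fibration_form G F6 F7 F8) != 0.
  by rewrite muni_fibration !mulf_neq0 ?polyXsubC_eq0.
by apply: contraNneq => ->; rewrite muni0.
Qed.

Lemma octic_birational G F6 F7 F8 :
  2%:R != 0 :> K -> G \is 5.-homog ->
  [/\ F6 \is 1.-homog, F7 \is 1.-homog & F8 \is 1.-homog] ->
  octic_form G F6 F7 F8 != 0 ->
  birational (tnth [tuple 1; 1; 1; 1; 4])%N (tnth [tuple 1; 1; 1; 6; 9])%N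
    (wproj_zeros (double_cover (octic_form G F6 F7 F8)))
    (wproj_zeros (double_cover (fibration_form G F6 F7 F8))).
Proof.
move=> two0 hG [h6 h7 h8] octic0.
set w8 := tnth [tuple 1; 1; 1; 1; 4]%N; set wE := tnth [tuple 1; 1; 1; 6; 9]%N.
pose a := tnth [tuple 0; 0; 0; 1; 1]%N; pose b := tnth [tuple 1; 1; 1; 0; 3]%N.
have a3 (i : 'I_3) : a (widen (widen i)) = 0%N by case: i => [[|[|[|//]]] ?].
have b3 (i : 'I_3) : b (widen (widen i)) = 1%N by case: i => [[|[|[|//]]] ?].
have w83 (i : 'I_3) : w8 (widen (widen i)) = 1%N by case: i => [[|[|[|//]]] ?].
have wE3 (i : 'I_3) : wE (widen (widen i)) = 1%N by case: i => [[|[|[|//]]] ?].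
have G0 : mwiden G != 0.
  by move: octic0; rewrite /octic_form !mulf_eq0 !negb_or -!andbA => /andP[].
have Gz : (mwiden G).@[fun=> 0] = 0 by rewrite meval_mwiden (meval_homog0 hG).
pose f v i := (tnth (scaling_map G a) i).@[v].
pose g v i := (tnth (scaling_map G b) i).@[v].
have fE v F d : F \is d.-homog -> F.@[base_point (f v)] = F.@[base_point v].
  by move=> hF; rewrite (meval_scaling_map _ _ hF a3) mul0n mul1r.
have gE v F d : F \is d.-homog ->
    F.@[base_point (g v)] = G.@[base_point v] ^+ d * F.@[base_point v].
  by move=> hF; rewrite (meval_scaling_map _ _ hF b3) mul1n.
exists (fun v => wproj_zeros (double_cover (octic_form G F6 F7 F8)) v /\
                 (mwiden (mwiden G)).@[v] != 0).
exists (fun v => wproj_zeros (double_cover (fibration_form G F6 F7 F8)) v /\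
                 (mwiden (mwiden G)).@[v] != 0).
split.
- exact: zopen_in_nonroot (dhomog_mwiden2 w83 hG).
- exact: (double_cover_dense two0 octic0 G0 Gz).
- exact: zopen_in_nonroot (dhomog_mwiden2 wE3 hG).
- exact: (double_cover_dense two0 (fibration_form_neq0 _ _ _ _) G0 Gz).
exists f, g; split.
- apply: (@polynomial_map_morphism _ _ _ _ _ 1).
    by apply: scaling_map_homog hG w83 _ => -[[|[|[|[|[|//]]]]] ?].
  move=> v [[_ +]]; rewrite -/(f v) /wproj_zeros !meval_mwiden2 (fE v _ _ hG) => vX Gv.
  split; last exact: Gv.
  split; first by apply: (nonzero_vec_base hG); rewrite (fE v _ _ hG).
  rewrite meval_fibration (fE v _ _ hG) (fE v _ _ h6) (fE v _ _ h7) (fE v _ _ h8).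
  rewrite /f !scaling_mapE.
  move: vX; rewrite meval_octic => /eqP; rewrite subr_eq0 exprMn => /eqP ->.
  (* With the values made variables, the claim is that [c ^+ 2] times the octic right-hand side puts
     one [c] into each of the three factors and uses up the [c] in front. *)
  move: (G.@[_]) (F6.@[_]) (F7.@[_]) (F8.@[_]) (v _) => c x y z s.
  by rewrite /a !(tnth_nth 0%N) /=; ring.
- apply: (@polynomial_map_morphism _ _ _ _ _ 6).
    by apply: scaling_map_homog hG wE3 _ => -[[|[|[|[|[|//]]]]] ?].
  move=> v [[_ +]]; rewrite -/(g v) /wproj_zeros !meval_mwiden2 => vY Gv.
  have Ggv : G.@[base_point (g v)] != 0 by rewrite (gE v _ _ hG) mulf_neq0 ?expf_neq0.
  split; last exact: Ggv.
  split; first exact: (nonzero_vec_base hG).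
  rewrite meval_octic (gE v _ _ hG) (gE v _ _ h6) (gE v _ _ h7) (gE v _ _ h8).
  rewrite /g !scaling_mapE.
  move: vY; rewrite meval_fibration => /eqP; rewrite subr_eq0 exprMn => /eqP ->.
  (* At the image point [G] has value [c ^+ 6] and the linear forms are multiplied by [c], so the
     octic right-hand side is [c ^+ 6] times that of the fibration, matching the square of
     [G ^+ 3 * U]. *)
  move: (G.@[_]) (F6.@[_]) (F7.@[_]) (F8.@[_]) (v _) => c x y z s.
  by rewrite /b !(tnth_nth 0%N) /=; ring.
- move=> v [_]; rewrite meval_mwiden2 => Gv; apply: (scaling_map_comp hG a3) => //.
  by move=> [[|[|[|[|[|//]]]]] ?].
- move=> v [_]; rewrite meval_mwiden2 => Gv; apply: (scaling_map_comp hG b3) => //.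
  by move=> [[|[|[|[|[|//]]]]] ?].
Qed.

End Birationality.

(** * Invariants of a cubic with given roots *)

Local Notation "x %:F" := (tofrac x) : ring_scope.

Lemma wc4_roots (A : comNzRingType) (e1 e2 e3 : A) :
  wc4 (curve_of_cubic (('X - e1%:P) * ('X - e2%:P) * ('X - e3%:P))) =
  16%:R * (e1 ^+ 2 + e2 ^+ 2 + e3 ^+ 2 - e1 * e2 - e1 * e3 - e2 * e3).
Proof.
rewrite prod3_XsubC_coef /wc4 /wb2 /wb4 /=.
by rewrite !(coefD, coefN, coefZ, coefXn, coefX, coefC) /=; ring.
Qed.

Lemma wdisc_scaled_roots (A : comNzRingType) (g a b c : A) :
  wdisc (curve_of_cubic
    (('X - (- (g * a))%:P) * ('X - (- (g * b))%:P) * ('X - (- (g * c))%:P))) =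
  16%:R * g ^+ 6 * (b - c) ^+ 2 * (a - c) ^+ 2 * (a - b) ^+ 2.
Proof. by rewrite wdisc_roots; ring. Qed.

Lemma wdisc_scaled_roots_neq0 (L : fieldType) (g a b c : L) :
  6%:R != 0 :> L -> g != 0 -> a != b -> a != c -> b != c ->
  wdisc (curve_of_cubic
    (('X - (- (g * a))%:P) * ('X - (- (g * b))%:P) * ('X - (- (g * c))%:P))) != 0.
Proof.
move=> n6 g0 ab ac bc.
have n16 : 16%:R != 0 :> L.
  have : 2%:R * 3%:R != 0 :> L by rewrite -natrM.
  by rewrite mulf_eq0 negb_or (natrX _ 2 4) => /andP[n2 _]; rewrite expf_neq0.
by rewrite wdisc_scaled_roots !mulf_neq0 ?expf_neq0 ?subr_eq0.
Qed.

Lemma monic_cubic_roots (A : idomainType) (e1 e2 e3 : A) :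
  ('X - e1%:P) * ('X - e2%:P) * ('X - e3%:P) \is monic /\
  size (('X - e1%:P) * ('X - e2%:P) * ('X - e3%:P)) = 4%N.
Proof.
rewrite !monicMl ?monicXsubC //.
by rewrite !size_Mmonic ?mulf_neq0 ?polyXsubC_eq0 ?monicXsubC // !size_XsubC.
Qed.

(** [wc4] is quadratic in the roots, so its cube carries the same [g ^+ 6] as the discriminant. The
    constant is [16 ^ 3 / (16 * 1728) = 4 / 27]. *)
Lemma wJ_scaled_roots (L : fieldType) (g a b c : L) :
  6%:R != 0 :> L -> g != 0 -> a != b -> a != c -> b != c ->
  wJ (curve_of_cubic
    (('X - (- (g * a))%:P) * ('X - (- (g * b))%:P) * ('X - (- (g * c))%:P))) =
  4%:R * (a ^+ 2 + b ^+ 2 + c ^+ 2 - a * b - a * c - b * c) ^+ 3 /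
  (27%:R * (b - c) ^+ 2 * (a - c) ^+ 2 * (a - b) ^+ 2).
Proof.
move=> n6 g0 ab ac bc; rewrite /wJ /wj wdisc_scaled_roots wc4_roots.
have : 2%:R * 3%:R != 0 :> L by rewrite -natrM.
rewrite mulf_eq0 negb_or => /andP[n2 n3].
have n16 : 16%:R != 0 :> L by rewrite (natrX _ 2 4) expf_neq0.
have n27 : 27%:R != 0 :> L by rewrite (natrX _ 3 3) expf_neq0.
have n1728 : 1728%:R != 0 :> L.
  by rewrite (_ : 1728 = 2 ^ 6 * 3 ^ 3)%N // natrM !natrX mulf_neq0 ?expf_neq0.
have [d0 d1 d2] : [/\ a - b != 0, a - c != 0 & b - c != 0] by rewrite !subr_eq0.
rewrite -[_ / _ / 1728%:R]mulrA -invfM; apply/eqP.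
rewrite eqr_div ?mulf_neq0 ?expf_neq0 //; apply/eqP; ring.
Qed.

Lemma map_tofrac_scaled_roots (A : idomainType) (g a b c : A) :
  map_poly (@tofrac A)
    (('X - (- (g * a))%:P) * ('X - (- (g * b))%:P) * ('X - (- (g * c))%:P)) =
  ('X - (- (g%:F * a%:F))%:P) * ('X - (- (g%:F * b%:F))%:P) *
  ('X - (- (g%:F * c%:F))%:P).
Proof.
by rewrite !rmorphM !rmorphB /= map_polyX !map_polyC /= !tofracN !tofracM.
Qed.

Section FractionField.
Context (A : idomainType) (g a b c : A).
Context (n6 : 6%:R != 0 :> A) (g0 : g != 0).
Context (ab : a != b) (ac : a != c) (bc : b != c).

Let p := ('X - (- (g * a))%:P) * ('X - (- (g * b))%:P) * ('X - (- (g * c))%:P).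

Let n6F : 6%:R != 0 :> {fraction A}.
Proof. by rewrite -(rmorph_nat (@tofrac _)) tofrac_eq0. Qed.

(** Injectivity of [tofrac] carries the nonvanishing conditions over to the fraction field. *)
Lemma wdisc_tofrac_neq0 : wdisc (curve_of_cubic (map_poly (@tofrac A) p)) != 0.
Proof. by rewrite map_tofrac_scaled_roots wdisc_scaled_roots_neq0 ?tofrac_eq0 ?tofrac_eq. Qed.

Lemma wJ_tofrac :
  wJ (curve_of_cubic (map_poly (@tofrac A) p)) =
  (4%:R * (a ^+ 2 + b ^+ 2 + c ^+ 2 - a * b - a * c - b * c) ^+ 3)%:F /
  (27%:R * (b - c) ^+ 2 * (a - c) ^+ 2 * (a - b) ^+ 2)%:F.
Proof.
rewrite map_tofrac_scaled_roots wJ_scaled_roots ?tofrac_eq0 ?tofrac_eq //.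
by rewrite !(tofracM, tofracXn, tofracD, tofracB, tofracN, tofracMn, tofrac1).
Qed.

End FractionField.

Theorem theorem2p1 (R : realType) (F1 F2 F3 F4 F5 F6 F7 F8 : {mpoly R[i][3]}) :
  [/\ F1 \is 1.-homog, F2 \is 1.-homog, F3 \is 1.-homog & F4 \is 1.-homog] ->
  [/\ F5 \is 1.-homog, F6 \is 1.-homog, F7 \is 1.-homog & F8 \is 1.-homog] ->
  let t : {mpoly R[i][4]} := 'X_ord_max in
  let planes : 'I_8 -> {mpoly R[i][4]} :=
    tnth [tuple mwiden F1; mwiden F2; mwiden F3; mwiden F4; mwiden F5;
                mwiden F6 + t; mwiden F7 + t; mwiden F8 + t] in
  let G : {mpoly R[i][3]} := F1 * F2 * F3 * F4 * F5 in
  let octic : {mpoly R[i][4]} :=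
    mwiden F1 * mwiden F2 * mwiden F3 * mwiden F4 * mwiden F5
    * (mwiden F6 + t) * (mwiden F7 + t) * (mwiden F8 + t) in
  let E : {mpoly R[i][4]} :=
    (mwiden (G * F6) + t) * (mwiden (G * F7) + t) * (mwiden (G * F8) + t) in
  octic_arrangement planes ->
  [/\ #|[set k | (planes k).@[tnth [tuple 0; 0; 0; 1]] == 0]| = 5%N,
      birational (tnth [tuple 1; 1; 1; 1; 4])%N (tnth [tuple 1; 1; 1; 6; 9])%N
        (wproj_zeros (double_cover octic)) (wproj_zeros (double_cover E)),
      elliptic_fibration E,
      wdisc (fibre_equation E) =
        16%:R * G ^+ 6 * (F7 - F8) ^+ 2 * (F6 - F8) ^+ 2 * (F6 - F7) ^+ 2 &
      wJ (generic_fibre E) =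
        tofrac (4%:R * (F6 ^+ 2 + F7 ^+ 2 + F8 ^+ 2
                        - F6 * F7 - F6 * F8 - F7 * F8) ^+ 3) /
        tofrac (27%:R * (F7 - F8) ^+ 2 * (F6 - F8) ^+ 2 * (F6 - F7) ^+ 2)].
Proof.
move=> [h1 h2 h3 h4] [h5 h6 h7 h8] t planes G octic E [lin distinct _ _].
have hG : G \is 5.-homog by rewrite /G -[5%N]/(1 + 1 + 1 + 1 + 1)%N !dhomogM.
have octicE : octic = octic_form G F6 F7 F8 by rewrite /octic /octic_form /G !mwidenM.
have plane_neq0 (k : nat) (lt_k8 : (k < 8)%N) :
    planes (Ordinal lt_k8) != 0 by case: (lin (Ordinal lt_k8)).
have octic0 : octic != 0.
  (* Each factor is, by computation, the form of one plane, hence nonzero; the left-nested product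
     is built up one factor at a time. *)
  have n0 k (lt_k8 : (k < 8)%N) p := @mulf_neq0 _ p _ ^~ (plane_neq0 k lt_k8).
  exact: (n0 7 isT _ (n0 6 isT _ (n0 5 isT _ (n0 4 isT _ (n0 3 isT _
    (n0 2 isT _ (n0 1 isT _ (plane_neq0 0 isT))))))))%N.
have G0 : G != 0.
  move: octic0; rewrite octicE; apply: contraNneq => ->.
  by rewrite /octic_form mwiden0 !mul0r.
(* Equal forms would have equal zero loci; for the last three planes this separates [F6], [F7],
   [F8]. *)
have distinctF i j : i != j -> planes i <> planes j.
  move=> ij eij; apply: (distinct _ _ ij); rewrite eij => v; exact: iff_refl.
have F67 : F6 != F7.
  apply/eqP => e; apply: (@distinctF (@Ordinal 8 5 isT) (@Ordinal 8 6 isT) isT).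
  by change (mwiden F6 + t = mwiden F7 + t); rewrite e.
have F68 : F6 != F8.
  apply/eqP => e; apply: (@distinctF (@Ordinal 8 5 isT) (@Ordinal 8 7 isT) isT).
  by change (mwiden F6 + t = mwiden F8 + t); rewrite e.
have F78 : F7 != F8.
  apply/eqP => e; apply: (@distinctF (@Ordinal 8 6 isT) (@Ordinal 8 7 isT) isT).
  by change (mwiden F7 + t = mwiden F8 + t); rewrite e.
have muniE : muni E =
    ('X - (- (G * F6))%:P) * ('X - (- (G * F7))%:P) * ('X - (- (G * F8))%:P).
  exact: muni_fibration.
have n6 : 6%:R != 0 :> {mpoly R[i][3]}.
  by rewrite -(rmorph_nat (@mpolyC 3 _)) mpolyC_eq0 Num.Theory.pnatr_eq0.
split.
(* At (0:0:0:1) linear forms in x, y, z vanish, while [F + t] takes the value 1. *)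
- have ptF (F : {mpoly R[i][3]}) :
      F \is 1.-homog -> (mwiden F).@[tnth [tuple 0; 0; 0; 1]] = 0.
    move=> hF; rewrite meval_mwiden -[RHS](meval_homog0 hF).
    by apply: meval_eq => -[[|[|[|//]]] ?].
  have ptFt (F : {mpoly R[i][3]}) :
      F \is 1.-homog -> (mwiden F + t).@[tnth [tuple 0; 0; 0; 1]] = 1.
    by move=> hF; rewrite mevalD (ptF _ hF) mevalXU add0r.
  have ptE k : ((planes k).@[tnth [tuple 0; 0; 0; 1]] == 0) = (k < 5)%N.
    by case: k => [[|[|[|[|[|[|[|[|//]]]]]]]] ?];
      rewrite /planes (tnth_nth 0) /= ?ptF ?ptFt ?eqxx ?oner_eq0.
  by rewrite cardsE (eq_card ptE) -sum1_card big_mkcond !big_ord_recl big_ord0.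
- have two0 : 2%:R != 0 :> R[i] by rewrite Num.Theory.pnatr_eq0.
  rewrite octicE in octic0 *.
  exact: (octic_birational two0 hG (And3 h6 h7 h8) octic0).
- have [mE sE] := monic_cubic_roots (- (G * F6)) (- (G * F7)) (- (G * F8)).
  rewrite /elliptic_fibration /generic_fibre muniE.
  by split; [exact: mE | exact: sE | exact: wdisc_tofrac_neq0].
- by rewrite /fibre_equation muniE wdisc_scaled_roots.
- by rewrite /generic_fibre muniE; exact: wJ_tofrac.
Qed.
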